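(* Let $Q$ be a Moufang loop and let $X$ be a normal subloop of $Q$. Then $X$ induces an abelian congruence of $Q$ if and only if both of the following hold: (i) every inner mapping of $Q$ restricts to an automorphism of $X$; and (ii) $u\cdot(x\cdot y) = (u\cdot y)\cdot x$ for all $u\in Q$ and all $x,y\in X$.
   Context: A loop is an algebra $(Q,\cdot,\backslash,/,1)$ satisfying $x\backslash(x\cdot y)=x\cdot(x\backslash y)=y=(y\cdot x)/x=(y/x)\cdot x$ and $x\cdot 1=x=1\cdot x$. A Moufang loop is a loop satisfying $x(y(xz))=((xy)x)z$ for all $x,y,z$. For $u\in Q$ the left and right translations are $L_u(v)=uv$ and $R_u(v)=vu$. The multiplication group is $\mathrm{Mlt}(Q)=\langle L_u,R_u:u\in Q\rangle$. An inner mapping of $Q$ is an element of $\mathrm{Mlt}(Q)$ that fixes $1$; the inner mappings form the group $\mathrm{Inn}(Q)$. A subloop $X$ of $Q$ is normal if $\varphi(X)=X$ for every $\varphi\in\mathrm{Inn}(Q)$ (equivalently, $X$ is the class containing $1$ of some congruence of $Q$). A normal subloop $X$ of $Q$ induces the congruence $\alpha_X$ of $Q$ given by $u\,\alpha_X\,v$ iff $uX=vX$. A congruence $\alpha$ of $Q$ is abelian if for every $n\ge 0$, every $(n+1)$-ary term operation $t$ in the signature $(\cdot,\backslash,/,1)$ and all $a,b,u_1,v_1,\dots,u_n,v_n\in Q$ with $a\,\alpha\,b$ and $u_i\,\alpha\,v_i$ for all $i$: if $t(a,u_1,\dots,u_n)=t(a,v_1,\dots,v_n)$ then $t(b,u_1,\dots,u_n)=t(b,v_1,\dots,v_n)$.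 ''$X$ induces an abelian congruence of $Q$'' means that $\alpha_X$ is abelian. *)

(* Defs.v *)
From mathcomp Require Import all_boot.
From mathcomp Require Import boolp classical_sets functions.
Set Implicit Arguments.
Unset Strict Implicit.
Unset Printing Implicit Defensive.

Declare Scope loop_scope.
Delimit Scope loop_scope with loop.
Local Open Scope classical_set_scope.

Record loop := Loop {
  carrier :> Type;
  mul : carrier -> carrier -> carrier;
  ldiv : carrier -> carrier -> carrier;
  rdiv : carrier -> carrier -> carrier;
  one : carrier;
  mulKl : forall x y, ldiv x (mul x y) = y;
  ldivKl : forall x y, mul x (ldiv x y) = y;
  mulKr : forall x y, rdiv (mul y x) x = y;
  rdivKr : forall x y, mul (rdiv y x) x = y;
  mulx1 : forall x, mul x one = x;
  mul1x : forall x, mul one x = x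
}.

Arguments one {l}.

(* [ldiv x y] is x\y and [rdiv x y] is x/y. *)
Notation "x * y" := (mul x y) : loop_scope.
Notation "1" := (one) : loop_scope.
Local Open Scope loop_scope.

Definition moufang (Q : loop) : Prop :=
  forall x y z : Q, x * (y * (x * z)) = ((x * y) * x) * z.

Definition ltrans (Q : loop) (u : Q) : Q -> Q := fun v => u * v.
Definition rtrans (Q : loop) (u : Q) : Q -> Q := fun v => v * u.

(* Mlt(Q), as the subgroup of Sym(Q) generated by the translations. *)
Inductive Mlt (Q : loop) : (Q -> Q) -> Prop :=
| Mlt_ltrans (u : Q) : Mlt (ltrans u)
| Mlt_rtrans (u : Q) : Mlt (rtrans u)
| Mlt_id : Mlt id
| Mlt_comp f g : Mlt f -> Mlt g -> Mlt (f \o g)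
| Mlt_inv f g : Mlt f -> cancel f g -> cancel g f -> Mlt g.

Definition inner_mapping (Q : loop) (f : Q -> Q) : Prop := Mlt f /\ f 1 = 1.

Record subloop (Q : loop) (X : set Q) : Prop := Subloop {
  subloop_one : X 1;
  subloop_mul : forall x y, X x -> X y -> X (x * y);
  subloop_ldiv : forall x y, X x -> X y -> X (ldiv x y);
  subloop_rdiv : forall x y, X x -> X y -> X (rdiv x y)
}.

Definition normal_subloop (Q : loop) (X : set Q) : Prop :=
  subloop X /\ forall f, inner_mapping f -> f @` X = X.

Record restricts_to_automorphism (Q : loop) (X : set Q) (f : Q -> Q) : Prop :=
  RestrictsToAutomorphism {
    aut_bij : set_bij X X f;
    aut_mul : forall x y, X x -> X y -> f (x * y) = f x * f y;
    aut_ldiv : forall x y, X x -> X y -> f (ldiv x y) = ldiv (f x) (f y);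
    aut_rdiv : forall x y, X x -> X y -> f (rdiv x y) = rdiv (f x) (f y);
    aut_one : f 1 = 1
  }.

Definition coset_congruence (Q : loop) (X : set Q) (u v : Q) : Prop :=
  ltrans u @` X = ltrans v @` X.

Inductive term (V : Type) : Type :=
| Var of V
| One
| Mul of term V & term V
| LDiv of term V & term V
| RDiv of term V & term V.

Arguments One {V}.

Fixpoint eval (Q : loop) (V : Type) (e : V -> Q) (t : term V) : Q :=
  match t with
  | Var i => e i
  | One => 1
  | Mul s t => eval e s * eval e t
  | LDiv s t => ldiv (eval e s) (eval e t)
  | RDiv s t => rdiv (eval e s) (eval e t)
  end.

(* The tuple (a, u_1, ..., u_n). *)
Definition consfun (T : Type) (n : nat) (a : T) (u : 'I_n -> T) :
    'I_n.+1 -> T :=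
  fun i => if unlift ord0 i is Some j then u j else a.

(* Intended for alpha a congruence of Q. *)
Definition abelian (Q : loop) (alpha : Q -> Q -> Prop) : Prop :=
  forall (n : nat) (t : term 'I_n.+1) (a b : Q) (u v : 'I_n -> Q),
    alpha a b -> (forall i, alpha (u i) (v i)) ->
    eval (consfun a u) t = eval (consfun a v) t ->
    eval (consfun b u) t = eval (consfun b v) t.

Definition induces_abelian_congruence (Q : loop) (X : set Q) : Prop :=
  abelian (coset_congruence X).

(* Main.v *)
(** For [x], [y] in [X], conditions (i) and (ii) make the multiplication of
    two cosets affine: [(u x)(v y) = (u v) (a x . b y)] with [a], [b] inner
    mappings.  The middle Moufang identity, conjugated by [v], gives
    [(u x)(v y) = v ((v^-1 (u x)) ((v y) v^-1)) v], where [(v y) v^-1] is in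
    [X], so that (ii) separates [x] from [y].  Hence every term operation is
    affine on products of cosets, with a linear part that is a homomorphism
    [X^n -> X], and the term condition follows.  Conversely, both (i) and (ii)
    say that some term [s(x, y)] with parameters is [1] on [X]; since
    [s(1, y) = 1 = s(1, 1)] and [s(x, 1) = 1], the term condition applies. *)
Require Import Defs.
From mathcomp Require Import all_boot.
From mathcomp Require Import boolp classical_sets functions.
Local Open Scope loop_scope.

(** * Moufang loops *)

Lemma mul_lcancel {Q : loop} (a b c : Q) : a * b = a * c -> b = c.
Proof. by move=> e; rewrite -(mulKl a b) e mulKl. Qed.

Lemma ldiv_eq {Q : loop} (a b c : Q) : a * c = b -> ldiv a b = c.
Proof. by move<-; rewrite mulKl. Qed.

Lemma rdiv_eq {Q : loop} (a b c : Q) : c * a = b -> rdiv b a = c.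
Proof. by move<-; rewrite mulKr. Qed.

Definition inv {Q : loop} (x : Q) : Q := ldiv x 1.

Lemma mulxV {Q : loop} (x : Q) : x * inv x = 1.
Proof. exact: ldivKl. Qed.

Section Moufang.
Context {Q : loop} (hQ : moufang Q).
Implicit Types u v w x y z : Q.

(** At [y := inv x] the right side of the Moufang identity collapses to [x * z], and [x] cancels on
    the left. *)
Lemma mulVK x z : inv x * (x * z) = z.
Proof. by apply: (mul_lcancel x); rewrite hQ mulxV mul1x. Qed.

Lemma mulVx x : inv x * x = 1.
Proof. by have := mulVK x 1; rewrite mulx1. Qed.

Lemma mulKV x z : x * (inv x * z) = z.
Proof. by apply: (mul_lcancel (inv x)); rewrite mulVK. Qed.

Lemma mulrK_inv x y : (y * x) * inv x = y.
Proof.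
apply: (mul_lcancel (inv x)); apply: (mul_lcancel x).
(* This instance of the Moufang identity reads [y = (y * x) * inv x] after cancellation. *)
by have := hQ x (inv x * y) (inv x); rewrite mulxV mulx1 !mulKV => <-.
Qed.

Lemma invM x y : inv (x * y) = inv y * inv x.
Proof.
apply: (mul_lcancel y); rewrite mulKV.
by have := mulrK_inv (x * y) (inv x); rewrite mulVK.
Qed.

Lemma invK x : inv (inv x) = x.
Proof. by apply: (mul_lcancel (inv x)); rewrite mulxV mulVx. Qed.

(** The last argument [inv x * inv z] is [inv (z * x)]. With it the Moufang identity becomes
    [x * y = (x * (y * z) * x) * inv (z * x)], and [z * x] moves to the other side. *)
Lemma middle_moufang x y z : (x * y) * (z * x) = x * (y * z) * x.
Proof.
have e := hQ x (y * z) (inv x * inv z).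
rewrite mulKV mulrK_inv in e.
by rewrite e -[z * x]invK invM mulrK_inv.
Qed.

(** The middle Moufang identity at [inv v] turns the inner product into [inv v * (u * w) * inv v],
    and the outer factors [v] cancel. *)
Lemma mul_conj u v w : u * w = v * (((inv v * u) * (w * inv v)) * v).
Proof.
rewrite middle_moufang; have := mulrK_inv (inv v) (inv v * (u * w)).
by rewrite invK => ->; rewrite mulKV.
Qed.

End Moufang.

(** * Inner mappings *)

Lemma Mlt_ldiv {Q : loop} (u : Q) : Mlt (ldiv u).
Proof.
apply: (@Mlt_inv _ (ltrans u)); first exact: Mlt_ltrans.
- exact: mulKl.
- exact: ldivKl.
Qed.

Lemma Mlt_bijective {Q : loop} (f : Q -> Q) : Mlt f ->
  exists g, cancel f g /\ cancel g f.
Proof.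
elim=> [u|u||f1 f2 _ [g1 [K1 K1']] _ [g2 [K2 K2']]|{}f g _ _ fK gK].
- by exists (ldiv u); split; [exact: mulKl | exact: ldivKl].
- by exists (fun x => rdiv x u); split=> x; [exact: mulKr | exact: rdivKr].
- by exists id.
- by exists (g2 \o g1); split; apply: can_comp.
- by exists f.
Qed.

Lemma inner_mapping_comp {Q : loop} (f g : Q -> Q) :
  inner_mapping f -> inner_mapping g -> inner_mapping (f \o g).
Proof.
move=> [mf f1] [mg g1]; split; first exact: Mlt_comp.
by rewrite /= g1.
Qed.

Lemma inner_mapping_inv {Q : loop} (f : Q -> Q) : inner_mapping f ->
  exists g, [/\ inner_mapping g, cancel f g & cancel g f].
Proof.
move=> [mf f1]; have [g [fK gK]] := Mlt_bijective f mf.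
exists g; split=> //; split; first exact: Mlt_inv fK gK.
by rewrite -f1 fK.
Qed.

Definition inner_l {Q : loop} (u v y : Q) : Q := ldiv (u * v) (u * (v * y)).

(** The counterpart of [inner_l] for a factor standing between [u] and [v]; at [v := inv u] it is
    conjugation by [u]. *)
Definition inner_lr {Q : loop} (u v x : Q) : Q := ldiv (u * v) ((u * x) * v).

Lemma inner_mapping_l {Q : loop} (u v : Q) : inner_mapping (inner_l u v).
Proof.
split; last by rewrite /inner_l mulx1 -[X in ldiv _ X]mulx1 mulKl.
apply: (@Mlt_comp _ (ldiv (u * v)) (ltrans u \o ltrans v)).
  exact: Mlt_ldiv.
by apply: Mlt_comp; apply: Mlt_ltrans.
Qed.

Lemma inner_mapping_lr {Q : loop} (u v : Q) : inner_mapping (inner_lr u v).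
Proof.
split; last by rewrite /inner_lr mulx1 -[X in ldiv _ X]mulx1 mulKl.
apply: (@Mlt_comp _ (ldiv (u * v)) (rtrans v \o ltrans u)).
  exact: Mlt_ldiv.
by apply: Mlt_comp; [apply: Mlt_rtrans | apply: Mlt_ltrans].
Qed.

Lemma inner_lE {Q : loop} (u v y : Q) : u * (v * y) = (u * v) * inner_l u v y.
Proof. by rewrite ldivKl. Qed.

Lemma inner_lrE {Q : loop} (u v x : Q) :
  (u * x) * v = (u * v) * inner_lr u v x.
Proof. by rewrite ldivKl. Qed.

(** * Conditions (i) and (ii) imply the term condition *)

Section AffineTerms.
Context {Q : loop} (hQ : moufang Q) {X : set Q} (hX : subloop X).
Context (autX : forall f : Q -> Q,
  inner_mapping f -> restricts_to_automorphism X f).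
Context (assocX : forall u x y : Q, X x -> X y -> u * (x * y) = (u * y) * x).

Lemma mulXC x y : X x -> X y -> x * y = y * x.
Proof. by move=> xX yX; have := assocX 1 x y xX yX; rewrite !mul1x. Qed.

(** Together with [mulXC] this makes [X] an abelian group acting on [Q] by right translations. *)
Lemma mulXA u x y : X x -> X y -> u * (x * y) = (u * x) * y.
Proof. by move=> xX yX; rewrite (mulXC x y) // assocX. Qed.

Lemma mulXACA x y z t : X x -> X y -> X z -> X t ->
  (x * y) * (z * t) = (x * z) * (y * t).
Proof.
move=> xX yX zX tX.
by rewrite !mulXA // -(mulXA x y z) // (mulXC y z) // mulXA.
Qed.

Lemma ldivX_mul x y z t : X x -> X y -> X z -> X t ->
  ldiv (x * y) (z * t) = ldiv x z * ldiv y t.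
Proof.
move=> xX yX zX tX; apply: ldiv_eq.
by rewrite mulXACA ?ldivKl //; apply: subloop_ldiv.
Qed.

Lemma inner_mapping_X f x : inner_mapping f -> X x -> X (f x).
Proof. by move=> /autX [[fX _ _] _ _ _ _] xX; apply: fX. Qed.

Lemma inner_mapping_mul f x y : inner_mapping f -> X x -> X y ->
  f (x * y) = f x * f y.
Proof. by move=> /autX [_ fM _ _ _]; apply: fM. Qed.

Lemma mul_cosets u v x y : X x -> X y ->
  (u * x) * (v * y) = (u * v) * (inner_lr u v x * inner_l u v y).
Proof.
move=> xX yX.
(* [a] moves [x] out of [inv v * (u * x)], [b] is conjugation by [v], and [h] carries a factor in
   [X] from inside [v * ((w * _) * v)] to the far right. *)
pose a := inner_l (inv v) u; pose b := inner_lr v (inv v).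
pose w := inv v * u.
pose h := inner_l v (w * v) \o inner_lr w v.
have ia : inner_mapping a by exact: inner_mapping_l.
have ib : inner_mapping b by exact: inner_mapping_lr.
have ih : inner_mapping h.
  apply: inner_mapping_comp; first exact: inner_mapping_l.
  exact: inner_mapping_lr.
have key x1 y1 : X x1 -> X y1 ->
    (u * x1) * (v * y1) = (u * v) * (h (a x1) * h (b y1)).
  move=> x1X y1X; have aX := inner_mapping_X a x1 ia x1X.
  have bX := inner_mapping_X b y1 ib y1X.
  rewrite (mul_conj hQ (u * x1) v) (inner_lE (inv v) u) (inner_lrE v (inv v)).
  rewrite mulxV mul1x -/a -/b -/w.
  (* Condition (ii) joins the two factors in [X], so that the single inner mapping [h] moves both
     and (i) splits them again. *)
  rewrite -(mulXA w) // inner_lrE inner_lE -[inner_l _ _ _]/(h (a x1 * b y1)).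
  rewrite (inner_mapping_mul h) //; congr (_ * _).
  by rewrite (mul_conj hQ u v v) mulxV mulx1.
have X1 := subloop_one hX.
have h1 := proj2 ih; have a1 := proj2 ia; have b1 := proj2 ib.
(* Setting [y] or [x] to 1 in [key] identifies the two inner mappings. *)
have -> : inner_lr u v x = h (a x).
  by apply: ldiv_eq; have := key x 1 xX X1; rewrite !mulx1 b1 h1 mulx1.
have -> : inner_l u v y = h (b y).
  by apply: ldiv_eq; have := key 1 y X1 yX; rewrite !mulx1 a1 h1 mul1x.
exact: key.
Qed.

(** [F] is chosen before [x], so one linear part serves the whole product of cosets. It stays a
    homomorphism through the induction by (i) and because [X] is an abelian group. *)
Lemma eval_cosets {V : Type} (u : V -> Q) (t : term V) :
  exists F : (V -> Q) -> Q, forall x, (forall i, X (x i)) ->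
    [/\ X (F x), eval (fun i => u i * x i) t = eval u t * F x
      & forall y, (forall i, X (y i)) -> F (fun i => x i * y i) = F x * F y].
Proof.
elim: t => [i||s [F hF] t [G hG]|s [F hF] t [G hG]|s [F hF] t [G hG]] /=.
- by exists (fun x => x i) => x xX; split.
- exists (fun=> 1) => x xX; split; rewrite ?mulx1 //; exact: subloop_one hX.
- set a := eval u s; set b := eval u t.
  have ia := inner_mapping_lr a b; have ib := inner_mapping_l a b.
  exists (fun x => inner_lr a b (F x) * inner_l a b (G x)) => x xX.
  have [FX eF FM] := hF x xX; have [GX eG GM] := hG x xX.
  have aFX := inner_mapping_X _ _ ia FX; have bGX := inner_mapping_X _ _ ib GX.
  split; first exact: subloop_mul.
    by rewrite eF eG mul_cosets.
  move=> y yX; have [FyX _ _] := hF y yX; have [GyX _ _] := hG y yX.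
  rewrite FM // GM // (inner_mapping_mul (inner_lr _ _)) //.
  rewrite (inner_mapping_mul (inner_l _ _)) //.
  by rewrite mulXACA //; apply: inner_mapping_X.
- set a := eval u s; set b := eval u t; pose w := ldiv a b.
  have ia := inner_mapping_lr a w; have ib := inner_mapping_l a w.
  have [g [ig _ gK]] := inner_mapping_inv _ ib.
  (* Since [a * w = b], the quotient is [w * z] with [inner_lr a w (F x) * inner_l a w z = G x];
     this is solved for [z]. *)
  exists (fun x => g (ldiv (inner_lr a w (F x)) (G x))) => x xX.
  have [FX eF FM] := hF x xX; have [GX eG GM] := hG x xX.
  have aFX := inner_mapping_X _ _ ia FX.
  have dX := subloop_ldiv hX aFX GX.
  have gX := inner_mapping_X _ _ ig dX.
  split=> //.
    by rewrite eF eG; apply: ldiv_eq; rewrite mul_cosets // gK !ldivKl.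
  move=> y yX; have [FyX _ _] := hF y yX; have [GyX _ _] := hG y yX.
  have aFyX := inner_mapping_X _ _ ia FyX.
  rewrite FM // GM // (inner_mapping_mul (inner_lr _ _)) // ldivX_mul //.
  rewrite (inner_mapping_mul g) //.
  exact: subloop_ldiv.
- set a := eval u s; set b := eval u t; pose w := rdiv a b.
  have ia := inner_mapping_lr w b; have ib := inner_mapping_l w b.
  have [g [ig _ gK]] := inner_mapping_inv _ ia.
  (* Here [z] solves [inner_lr w b z * inner_l w b (G x) = F x]; a left division suffices as [X] is
     commutative. *)
  exists (fun x => g (ldiv (inner_l w b (G x)) (F x))) => x xX.
  have [FX eF FM] := hF x xX; have [GX eG GM] := hG x xX.
  have bGX := inner_mapping_X _ _ ib GX.
  have dX := subloop_ldiv hX bGX FX.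
  have gX := inner_mapping_X _ _ ig dX.
  split=> //.
    rewrite eF eG; apply: rdiv_eq; rewrite mul_cosets // gK.
    by rewrite (mulXC (ldiv _ _)) // ldivKl rdivKr.
  move=> y yX; have [FyX _ _] := hF y yX; have [GyX _ _] := hG y yX.
  have bGyX := inner_mapping_X _ _ ib GyX.
  rewrite FM // GM // (inner_mapping_mul (inner_l _ _)) // ldivX_mul //.
  rewrite (inner_mapping_mul g) //.
  exact: subloop_ldiv.
Qed.

Lemma coset_congruence_mul u v : coset_congruence X u v ->
  exists2 x, X x & v = u * x.
Proof.
move=> e; have : (ltrans v @` X)%classic v.
  by exists 1; [exact: subloop_one hX | exact: mulx1].
by rewrite -e => -[x xX <-]; exists x.
Qed.

(** Write [b = a * x] and [v i = u i * y i]. The hypothesis says that [F] is 1 at [(1, y)], hence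
    [F] takes the same value at [(x, y)] as at [(x, 1)]. *)
Lemma abelian_coset_congruence : induces_abelian_congruence X.
Proof.
move=> n t a b u v /coset_congruence_mul [x xX ->] uv.
have /choice [y hy] : forall i, exists y, X y /\ v i = u i * y.
  by move=> i; have [y yX ->] := coset_congruence_mul _ _ (uv i); exists y.
have [F hF] := eval_cosets (consfun a u) t.
have X1 := subloop_one hX.
have consX x0 (y0 : 'I_n -> Q) : X x0 -> (forall i, X (y0 i)) ->
    forall i, X (consfun x0 y0 i).
  by move=> x0X y0X i; rewrite /consfun; case: (unlift _ _).
have cons_mul c x0 d y0 :
    consfun (c * x0) (fun i : 'I_n => d i * y0 i) =
    (fun i => consfun c d i * consfun x0 y0 i).
  by apply/funext=> i; rewrite /consfun; case: (unlift _ _).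
have vE : v = fun i => u i * y i by apply/funext=> i; case: (hy i).
have uE : u = fun i => u i * 1 by apply/funext=> i; rewrite mulx1.
have yX i : X (y i) by case: (hy i).
have c1X := consX x (fun=> 1) xX (fun=> X1).
have c2X := consX 1 y X1 yX.
have [_ e1 FM] := hF _ c1X; have [_ e2 _] := hF _ c2X.
have -> : eval (consfun (a * x) u) t = eval (consfun a u) t *
    F (consfun x (fun=> 1)) by rewrite -e1 -cons_mul -uE.
have -> : eval (consfun a v) t = eval (consfun a u) t *
    F (consfun 1 y) by rewrite -e2 -cons_mul -vE mulx1.
rewrite -[X in X = _ -> _]mulx1 => /mul_lcancel F1.
have [_ e3 _] := hF _ (consX x y xX yX).
rewrite vE cons_mul e3; congr (_ * _).
have -> : consfun x y = fun i => consfun x (fun=> 1) i * consfun 1 y i.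
  by rewrite -cons_mul mulx1; congr consfun; apply/funext=> i; rewrite mul1x.
by rewrite FM // -F1 mulx1.
Qed.

End AffineTerms.

(** * The term condition implies (i) and (ii) *)

Local Arguments Var {V}.

Fixpoint subst {V W : Type} (s : V -> term W) (t : term V) : term W :=
  match t with
  | Var i => s i
  | One => One
  | Mul p q => Mul (subst s p) (subst s q)
  | LDiv p q => LDiv (subst s p) (subst s q)
  | RDiv p q => RDiv (subst s p) (subst s q)
  end.

Lemma eval_subst {Q : loop} {V W : Type} (s : V -> term W) (e : W -> Q)
    (t : term V) :
  eval e (subst s t) = eval (fun i => eval e (s i)) t.
Proof. by elim: t => //= p -> q ->. Qed.

Lemma eval_ext {Q : loop} {V : Type} (e e' : V -> Q) (t : term V) :
  e =1 e' -> eval e t = eval e' t.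
Proof. by move=> ee; elim: t => //= p -> q ->. Qed.

(* Each occurrence of a variable [Some w] becomes a variable of its own. *)
Lemma term_ordP {W : Type} (t : term (option W)) :
  exists n (t' : term 'I_n.+1) (p : 'I_n -> W),
    forall (Q : loop) (a : Q) (u : W -> Q),
      eval (oapp u a) t = eval (consfun a (u \o p)) t'.
Proof.
(* Variable 0 is shared by both subterms, while their parameters go to disjoint blocks. *)
pose shiftl m n (i : 'I_m.+1) : 'I_(m + n).+1 :=
  if unlift ord0 i is Some j then lift ord0 (lshift n j) else ord0.
pose shiftr m n (i : 'I_n.+1) : 'I_(m + n).+1 :=
  if unlift ord0 i is Some j then lift ord0 (rshift m j) else ord0.
pose join m n (p : 'I_m -> W) (q : 'I_n -> W) (i : 'I_(m + n)) :=
  match fintype.split i with inl j => p j | inr j => q j end.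
have joinl m n p q t1 (Q : loop) (a : Q) (u : W -> Q) :
    eval (consfun a (u \o join m n p q)) (subst (Var \o shiftl m n) t1) =
    eval (consfun a (u \o p)) t1.
  rewrite eval_subst; apply: eval_ext => i /=; rewrite /consfun /shiftl.
  case: (unlift ord0 i) => [j|]; last by rewrite unlift_none.
  by rewrite liftK /= /join -[lshift n j]/(unsplit (inl j)) unsplitK.
have joinr m n p q t1 (Q : loop) (a : Q) (u : W -> Q) :
    eval (consfun a (u \o join m n p q)) (subst (Var \o shiftr m n) t1) =
    eval (consfun a (u \o q)) t1.
  rewrite eval_subst; apply: eval_ext => i /=; rewrite /consfun /shiftr.
  case: (unlift ord0 i) => [j|]; last by rewrite unlift_none.
  by rewrite liftK /= /join -[rshift m j]/(unsplit (inr j)) unsplitK.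
pose no_param (i : 'I_0) : W := False_rect W (notF (ltn_ord i)).
elim: t => [[w|]||s [m [s' [p hs]]] t [n [t' [q ht]]]
  |s [m [s' [p hs]]] t [n [t' [q ht]]]|s [m [s' [p hs]]] t [n [t' [q ht]]]].
- exists 1%N, (Var (lift ord0 ord0)), (fun=> w) => Q a u.
  by rewrite /= /consfun liftK.
- exists 0%N, (Var ord0), no_param.
  by move=> Q a u; rewrite /= /consfun unlift_none.
- exists 0%N, One, no_param.
  by [].
- exists (m + n)%N, (Mul (subst (Var \o shiftl m n) s')
    (subst (Var \o shiftr m n) t')), (join m n p q) => Q a u.
  by rewrite /= joinl joinr hs ht.
- exists (m + n)%N, (LDiv (subst (Var \o shiftl m n) s')
    (subst (Var \o shiftr m n) t')), (join m n p q) => Q a u.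
  by rewrite /= joinl joinr hs ht.
- exists (m + n)%N, (RDiv (subst (Var \o shiftl m n) s')
    (subst (Var \o shiftr m n) t')), (join m n p q) => Q a u.
  by rewrite /= joinl joinr hs ht.
Qed.

(** With parameters indexed by any type, every element of [Q] can occur in a term as a constant. *)
Lemma abelian_term {Q : loop} (alpha : Q -> Q -> Prop) {W : Type}
    (t : term (option W)) (a b : Q) (u v : W -> Q) :
  abelian alpha -> alpha a b -> (forall w, alpha (u w) (v w)) ->
  eval (oapp u a) t = eval (oapp v a) t ->
  eval (oapp u b) t = eval (oapp v b) t.
Proof.
move=> abel ab uv; have [n [t' [p E]]] := term_ordP t.
by rewrite !E; apply: abel => // i; apply: uv.
Qed.

(* In [term (option Q)], [Some q] stands for the constant [q]. *)
Lemma Mlt_term {Q : loop} (f : Q -> Q) : Mlt f ->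
  exists t : term (option Q), forall z, eval (oapp id z) t = f z.
Proof.
pose poly f := exists t : term (option Q), forall z, eval (oapp id z) t = f z.
(* [Mlt_inv] makes the induction require a polynomial inverse as well. *)
move=> mf; suff [] : poly f /\ (exists g, [/\ poly g, cancel f g & cancel g f]).
  by [].
elim: mf => [u|u||f1 f2 _ [[t1 E1] [g1 [[s1 D1] K1 K1']]] _
  [[t2 E2] [g2 [[s2 D2] K2 K2']]]|{}f g _ [pf [g' [pg' K K']]] fK gK].
- split; first by exists (Mul (Var (Some u)) (Var None)).
  exists (ldiv u); split; [|exact: mulKl|exact: ldivKl].
  by exists (LDiv (Var (Some u)) (Var None)).
- split; first by exists (Mul (Var None) (Var (Some u))).
  exists (fun x => rdiv x u); split=> [|x|x]; [|exact: mulKr|exact: rdivKr].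
  by exists (RDiv (Var None) (Var (Some u))).
- have pid : poly id by exists (Var None).
  by split=> //; exists id.
- have pcomp h1 h2 (r1 r2 : term (option Q)) :
      (forall z, eval (oapp id z) r1 = h1 z) ->
      (forall z, eval (oapp id z) r2 = h2 z) -> poly (h1 \o h2).
    move=> H1 H2; exists (subst (oapp (Var \o Some) r2) r1) => z.
    rewrite eval_subst /= -H2 -H1; apply: eval_ext => -[q|] //=.
  split; first exact: pcomp E1 E2.
  exists (g2 \o g1); split; first exact: pcomp D2 D1.
  + exact: can_comp.
  + exact: can_comp.
(* Inverses are unique, so [g] is the polynomial inverse given by induction. *)
- have -> : g = g' by apply/funext=> z; rewrite -{1}(K' z) fK.
  by split=> //; exists f.
Qed.

Lemma coset_congruence1 {Q : loop} {X : set Q} x : subloop X -> X x ->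
  coset_congruence X 1 x.
Proof.
move=> hX xX; apply/seteqP; split=> z [y yX <-]; rewrite /ltrans ?mul1x.
  by exists (ldiv x y); [exact: subloop_ldiv|rewrite ldivKl].
by exists (x * y); [exact: subloop_mul|rewrite mul1x].
Qed.

(* In [option (option Q)], [None] and [Some None] are the variables [x] and
   [y], and [Some (Some q)] is the constant [q]. *)
Lemma abelian_eq1 {Q : loop} {X : set Q} (t : term (option (option Q)))
    (s : Q -> Q -> Q) :
  subloop X -> induces_abelian_congruence X ->
  (forall x y, eval (oapp (oapp id y) x) t = s x y) ->
  (forall x, s x 1 = 1) -> (forall y, s 1 y = 1) ->
  forall x y, X x -> X y -> s x y = 1.
Proof.
move=> hX abel E sx1 s1y x y xX yX.
rewrite -(sx1 x) -!E; apply: (abelian_term (coset_congruence X) _ 1 x) => //.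
- exact: coset_congruence1.
- by case=> [q|] //=; apply/esym; apply: coset_congruence1.
- by rewrite !E !s1y.
Qed.

(** Normality gives bijectivity on [X]. As [f] is a polynomial fixing 1, the defect
    [ldiv (f (x * y)) (f x * f y)] is a polynomial that is 1 when [x] or [y] is, so [abelian_eq1]
    gives multiplicativity; the divisions follow. *)
Lemma inner_mapping_restricts {Q : loop} {X : set Q} (f : Q -> Q) :
  normal_subloop X -> induces_abelian_congruence X -> inner_mapping f ->
  restricts_to_automorphism X f.
Proof.
move=> [hX nX] abel hf; have [mf f1] := hf; have fX := nX f hf.
have [g [fK gK]] := Mlt_bijective f mf; have [t E] := Mlt_term f mf.
have fXX x : X x -> X (f x) by move=> xX; rewrite -fX; exists x.
(* [app r] is the term for [f] applied to [r]: the variable of [t] is replaced by [r] and its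
   constants are kept. *)
pose app (r : term (option (option Q))) :=
  subst (oapp (Var \o Some \o Some) r) t.
have appE r e : eval (oapp (oapp id e.1) e.2) (app r) =
    f (eval (oapp (oapp id e.1) e.2) r).
  by rewrite eval_subst -E; apply: eval_ext => -[q|].
have fM x y : X x -> X y -> f (x * y) = f x * f y.
  move=> xX yX.
  suff e : ldiv (f (x * y)) (f x * f y) = 1.
    by rewrite -[RHS](ldivKl (f (x * y))) e mulx1.
  apply: (abelian_eq1 (LDiv (app (Mul (Var None) (Var (Some None))))
    (Mul (app (Var None)) (app (Var (Some None)))))
    (fun x y => ldiv (f (x * y)) (f x * f y)) hX abel) => //= {x y xX yX}.
  + by move=> x y; rewrite !(appE _ (y, x)).
  + by move=> x; apply: ldiv_eq; rewrite f1 !mulx1.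
  + by move=> y; apply: ldiv_eq; rewrite f1 !mul1x mulx1.
split=> //.
- split; [exact: fXX | by move=> x y _ _ /(can_inj fK) |].
  by move=> y yX; rewrite -fX in yX.
- move=> x y xX yX; apply/esym/ldiv_eq.
  by rewrite -fM ?ldivKl //; apply: subloop_ldiv.
- move=> x y xX yX; apply/esym/rdiv_eq.
  by rewrite -fM ?rdivKr //; apply: subloop_rdiv.
Qed.

(** The left quotient of the two sides is 1 as soon as [x] or [y] is. *)
Lemma abelian_mulC {Q : loop} {X : set Q} (u x y : Q) :
  subloop X -> induces_abelian_congruence X -> X x -> X y ->
  u * (x * y) = (u * y) * x.
Proof.
move=> hX abel xX yX.
suff e : ldiv ((u * y) * x) (u * (x * y)) = 1.
  by rewrite -[LHS](ldivKl ((u * y) * x)) e mulx1.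
apply: (abelian_eq1 (LDiv
  (Mul (Mul (Var (Some (Some u))) (Var (Some None))) (Var None))
  (Mul (Var (Some (Some u))) (Mul (Var None) (Var (Some None)))))
  (fun x y => ldiv ((u * y) * x) (u * (x * y))) hX abel) => //= {x y xX yX}.
- by move=> x; apply: ldiv_eq; rewrite !mulx1.
- by move=> y; apply: ldiv_eq; rewrite mul1x !mulx1.
Qed.

Theorem theorem2p2 (Q : loop) (hQ : moufang Q) (X : set Q)
    (hX : normal_subloop X) :
  induces_abelian_congruence X <->
  (forall f : Q -> Q, inner_mapping f -> restricts_to_automorphism X f) /\
  (forall u x y : Q, X x -> X y -> u * (x * y) = (u * y) * x).
Proof.
split=> [abel|[autX assocX]].
  split=> [f hf|u x y]; first exact: inner_mapping_restricts.
  by apply: abelian_mulC abel; case: hX.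
exact: (abelian_coset_congruence hQ (proj1 hX)).
Qed.
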